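(* Let $\lambda>1$, $\theta>0$, $\lambda_j=\lambda^j$. Let $(A_j)_{j\ge0}$, $(B_j)_{j\ge0}$ be real sequences with $\sum_{j\ge0}\lambda_j^{-\frac23\theta}(A_j^2+B_j^2)<\infty$ satisfying $$A_{j-1}^2-A_jA_{j+1}+B_{j-1}^2-B_jB_{j+1}=0,\quad j\ge1,$$ $$A_jB_{j+1}-B_jA_{j+1}=0,\quad j\ge1,$$ $$-A_0A_1-B_0B_1=-1,$$ $$A_0B_1-B_0A_1=0.$$ Then $$A_j=A_0,\qquad B_j=B_0,\qquad \forall\, j\ge1,$$ and the constants $A_0,B_0$ satisfy $A_0^2+B_0^2=1$.
   Context: These equations are the stationary equations of the system $$\frac{d}{dt}a_j=-\left(\lambda_j^{\theta}a_ja_{j+1}-\lambda_{j-1}^{\theta}a_{j-1}^2\right)-\left(\lambda_j^{\theta}b_jb_{j+1}-\lambda_{j-1}^{\theta}b_{j-1}^2\right)+f_j,\qquad \frac{d}{dt}b_j=\lambda_j^{\theta}a_jb_{j+1}-\lambda_j^{\theta}b_ja_{j+1}$$ ($j\ge0$, $a_{-1}=b_{-1}=0$, $f_0>0$, $f_j=0$ for $j\ge1$), written in the rescaled variables $A_j=\lambda^{-\frac16\theta}f_0^{-\frac12}\lambda_j^{\frac13\theta}a_j$, $B_j=\lambda^{-\frac16\theta}f_0^{-\frac12}\lambda_j^{\frac13\theta}b_j$. The summability condition says exactly that the steady state $(a,b)$ lies in $l^2\times l^2$. *)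

(* Defs.v *)
From Stdlib Require Import Reals.
Open Scope R_scope.

Definition lambda_ (lambda : R) (j : nat) : R := lambda ^ j.

(* Main.v *)
Require Import Defs.
From Stdlib Require Import Reals Lra Lia.
From Coquelicot Require Import Coquelicot.
Open Scope R_scope.

(** Write [v j = (A j, B j)] and [s j = |v j|^2].  Lagrange's identity
    [|v|^2 |w|^2 = (v . w)^2 + (v x w)^2] turns the equations into
    [s 0 * s 1 = 1] and [s (j+1) * s (j+2) = s j ^ 2], so that [x = ln s]
    satisfies [x (j+1) = x 0 - 2 x j].  Hence [x j - x 0 / 3] is
    [(2/3) (-2)^j x 0], whereas summability bounds [x] linearly from above, and
    the recurrence turns this into a linear lower bound.  Therefore [x = 0],
    all [v j] are unit vectors, and [v j . v (j+1) = 1] forces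
    [v (j+1) = v j]. *)

(** Bernoulli's inequality, squared: quadratic growth along even exponents already beats any linear
    function. *)
Lemma pow2_even_ge (m : nat) : (1 + INR m) ^ 2 <= 2 ^ (2 * m).
Proof.
assert (H : 1 + INR m * 1 <= (1 + 1) ^ m) by (apply poly; lra).
replace (2 ^ (2 * m)) with ((2 ^ m) ^ 2) by (rewrite <- pow_mult; f_equal; lia).
replace (1 + 1) with 2 in H by ring.
apply pow_incr; pose proof (pos_INR m); lra.
Qed.

Lemma pow2_linear_bound_nonpos (c a mu : R) (N : nat) (Hmu : 0 <= mu)
  (H : forall j : nat, (N <= j)%nat -> c * 2 ^ j <= a + mu * INR j) : c <= 0.
Proof.
destruct (Rle_lt_dec c 0) as [Hc | Hc]; [exact Hc | exfalso].
(* The threshold makes [c * m] exceed [Rabs a + 2 * mu], so [c * (1 + m) ^ 2] exceeds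
   [a + mu * (2 * m)]; adding [N] puts the index [2 * m] in the range of [H]. *)
destruct (INR_unbounded ((Rabs a + 2 * mu) / c)) as [k Hk].
set (m := (k + N)%nat).
assert (Hkm : INR k <= INR m) by (apply le_INR; unfold m; lia).
pose proof (H (2 * m)%nat ltac:(unfold m; lia)) as Hm.
rewrite mult_INR in Hm; change (INR 2) with 2 in Hm.
pose proof (pow2_even_ge m) as Hp.
pose proof (pos_INR m) as Hm0.
pose proof (Rle_abs a) as Ha; pose proof (Rabs_pos a) as Ha0.
assert (Hlt : Rabs a + 2 * mu < c * INR m).
{ apply Rlt_le_trans with (c * INR k).
  - apply Rmult_lt_reg_r with (/ c); [now apply Rinv_0_lt_compat |].
    replace (c * INR k * / c) with (INR k) by (field; lra). exact Hk.
  - apply Rmult_le_compat_l; lra. }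
assert (c * (1 + INR m) ^ 2 <= c * 2 ^ (2 * m)) by (apply Rmult_le_compat_l; lra).
assert ((Rabs a + 2 * mu) * (1 + INR m) <= c * INR m * (1 + INR m))
  by (apply Rmult_le_compat_r; lra).
nra.
Qed.

(** The distance to the fixed point [x 0 / 3] doubles at each step, starting from
    [2 / 3 * Rabs (x 0)]. A one-sided bound suffices, since an upper bound on [x (S j)] is a lower
    bound on [x j]. *)
Lemma affine_recurrence_linear_bound_zero (x : nat -> R) (mu : R) (N : nat)
  (Hmu : 0 <= mu)
  (Hrec : forall j : nat, x (S j) = x 0%nat - 2 * x j)
  (Hbound : forall j : nat, (N <= j)%nat -> x j <= mu * INR j) :
  forall j : nat, x j = 0.
Proof.
assert (Hgrow : forall j, Rabs (x j - x 0%nat / 3) = Rabs (2 / 3 * x 0%nat) * 2 ^ j).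
{ induction j as [|j IH].
  - rewrite Rmult_1_r; f_equal; field.
  - rewrite Hrec.
    replace (x 0%nat - 2 * x j - x 0%nat / 3) with (- 2 * (x j - x 0%nat / 3)) by field.
    rewrite Rabs_mult, IH, (Rabs_left (-2)) by lra; simpl; ring. }
assert (H0 : Rabs (2 / 3 * x 0%nat) <= 0).
(* The constant [a] absorbs the terms in [x 0] and the extra [mu] coming from the bound at [S j]. *)
{ apply pow2_linear_bound_nonpos with (a := Rabs (x 0%nat) + mu) (mu := mu) (N := N);
    [exact Hmu |].
  intros j Hj; rewrite <- Hgrow.
  pose proof (Hbound j Hj) as H1.
  pose proof (Hbound (S j) ltac:(lia)) as H2; rewrite S_INR, Hrec in H2.
  assert (0 <= mu * INR j) by (apply Rmult_le_pos; [exact Hmu | apply pos_INR]).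
  apply Rabs_le; pose proof (Rle_abs (x 0%nat)).
  pose proof (Rle_abs (- x 0%nat)) as H3; rewrite Rabs_Ropp in H3.
  lra. }
assert (Hx0 : x 0%nat = 0).
{ pose proof (Rle_abs (2 / 3 * x 0%nat)).
  pose proof (Rle_abs (- (2 / 3 * x 0%nat))) as H3; rewrite Rabs_Ropp in H3. lra. }
induction j as [|j IH]; [exact Hx0 |].
rewrite Hrec, Hx0, IH; ring.
Qed.

(** The terms of a convergent series tend to 0, so they are eventually below 1; the bound is the
    logarithm of that inequality. *)
Lemma summable_weighted_ln_bound (lambda p : R) (s : nat -> R)
  (Hlambda : 0 < lambda) (Hs : forall j : nat, 0 < s j)
  (Hsum : ex_series (fun j : nat => Rpower (lambda_ lambda j) (- p) * s j)) :
  exists N : nat, forall j : nat, (N <= j)%nat -> ln (s j) <= p * ln lambda * INR j.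
Proof.
apply ex_series_lim_0, is_lim_seq_spec in Hsum.
destruct (Hsum (mkposreal 1 Rlt_0_1)) as [N HN]; exists N; intros j Hj.
specialize (HN j Hj); simpl in HN.
apply Rabs_lt_between in HN.
assert (Hln : ln (Rpower (lambda_ lambda j) (- p) * s j) < ln 1).
{ apply ln_increasing; [| lra].
  apply Rmult_lt_0_compat; [apply exp_pos | apply Hs]. }
rewrite ln_1, ln_mult in Hln; [| apply exp_pos | apply Hs].
unfold Rpower, lambda_ in Hln; rewrite ln_exp, ln_pow in Hln by exact Hlambda.
lra.
Qed.

Theorem lemma6p1 (lambda theta : R) (A B : nat -> R)
  (hlambda : 1 < lambda) (htheta : 0 < theta)
  (hsum : ex_series (fun j : nat =>
            Rpower (lambda_ lambda j) (- (2 / 3) * theta)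
              * (A j ^ 2 + B j ^ 2)))
  (hA : forall j : nat, (1 <= j)%nat ->
          A (j - 1)%nat ^ 2 - A j * A (j + 1)%nat
            + B (j - 1)%nat ^ 2 - B j * B (j + 1)%nat = 0)
  (hB : forall j : nat, (1 <= j)%nat ->
          A j * B (j + 1)%nat - B j * A (j + 1)%nat = 0)
  (hA0 : - A 0%nat * A 1%nat - B 0%nat * B 1%nat = -1)
  (hB0 : A 0%nat * B 1%nat - B 0%nat * A 1%nat = 0) :
  (forall j : nat, (1 <= j)%nat -> A j = A 0%nat /\ B j = B 0%nat) /\
  A 0%nat ^ 2 + B 0%nat ^ 2 = 1.
Proof.
set (s := fun j => A j ^ 2 + B j ^ 2).
assert (Hdot : forall j, A (S j) * A (S (S j)) + B (S j) * B (S (S j)) = s j).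
{ intro j; pose proof (hA (S j) ltac:(lia)) as H.
  replace (S j - 1)%nat with j in H by lia.
  replace (S j + 1)%nat with (S (S j)) in H by lia.
  unfold s; lra. }
assert (Hcross : forall j, A j * B (S j) - B j * A (S j) = 0).
{ intros [|j]; [exact hB0 |].
  pose proof (hB (S j) ltac:(lia)) as H.
  now replace (S j + 1)%nat with (S (S j)) in H by lia. }
assert (Hlagrange : forall j, s j * s (S j) = (A j * A (S j) + B j * B (S j)) ^ 2).
{ intro j; transitivity ((A j * A (S j) + B j * B (S j)) ^ 2
                         + (A j * B (S j) - B j * A (S j)) ^ 2).
  - unfold s; ring.
  - rewrite Hcross; ring. }
assert (Hs01 : s 0%nat * s 1%nat = 1).
{ rewrite Hlagrange.
  replace (A 0%nat * A 1%nat + B 0%nat * B 1%nat) with 1 by lra; ring. }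
assert (Hsrec : forall j, s (S j) * s (S (S j)) = s j ^ 2).
{ intro j; now rewrite Hlagrange, Hdot. }
assert (Hnonneg : forall j, 0 <= s j) by (intro j; unfold s; nra).
(* Logarithms require positivity. The recurrence is of second order, so the induction carries two
   consecutive terms; [Hs01] starts it. *)
assert (Hpos : forall j, 0 < s j).
{ assert (H : forall j, 0 < s j /\ 0 < s (S j)).
  { induction j as [|j [IH1 IH2]].
    - pose proof (Hnonneg 0%nat); pose proof (Hnonneg 1%nat); split; nra.
    - split; [exact IH2 |].
      pose proof (Hsrec j); pose proof (Hnonneg (S (S j))); nra. }
  intro j; apply H. }
(* With [x j = ln (s j)], [Hsrec] says that [x (S j) + 2 * x j] does not depend on [j]; its value at
   0 is [x 0], because [Hs01] gives [x 1 = - x 0]. *)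
assert (Hxrec : forall j, ln (s (S j)) = ln (s 0%nat) - 2 * ln (s j)).
{ induction j as [|j IH].
  - pose proof (f_equal ln Hs01) as H.
    rewrite ln_1, ln_mult in H by apply Hpos; lra.
  - pose proof (f_equal ln (Hsrec j)) as H.
    rewrite ln_mult, ln_pow in H by apply Hpos; simpl INR in H; lra. }
destruct (summable_weighted_ln_bound lambda (2 / 3 * theta) s ltac:(lra) Hpos)
  as [N HN].
{ apply ex_series_ext with (2 := hsum); intro j.
  unfold s; do 2 f_equal; ring. }
assert (Hs1 : forall j, s j = 1).
{ intro j; apply ln_inv; [apply Hpos | lra |]; rewrite ln_1.
  apply (affine_recurrence_linear_bound_zero (fun i => ln (s i))
           (2 / 3 * theta * ln lambda) N); [| exact Hxrec | exact HN].
  pose proof (ln_increasing 1 lambda Rlt_0_1 hlambda) as Hl; rewrite ln_1 in Hl.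
  nra. }
assert (Hdot1 : forall j, A j * A (S j) + B j * B (S j) = 1).
{ intros [|j]; [lra |]; now rewrite Hdot. }
assert (Hstep : forall j, A (S j) = A j /\ B (S j) = B j).
{ intro j; pose proof (Hs1 j) as H1; pose proof (Hs1 (S j)) as H2.
  pose proof (Hdot1 j) as H3; unfold s in H1, H2.
  (* Expanding the squared distance of two unit vectors with inner product 1 gives
     [1 + 1 - 2 = 0]. *)
  assert (H : (A (S j) - A j) ^ 2 + (B (S j) - B j) ^ 2 = 0) by lra.
  pose proof (pow2_ge_0 (A (S j) - A j)); pose proof (pow2_ge_0 (B (S j) - B j)).
  split; apply Rminus_diag_uniq, Rsqr_0_uniq; rewrite Rsqr_pow2; lra. }
split; [| exact (Hs1 0%nat)].
intros j _; induction j as [|j [IHA IHB]]; [now split |].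
destruct (Hstep j) as [HA HB]; rewrite HA, HB; now split.
Qed.
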